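(* Let $G$ be a finite group and $(\mathcal{E},S)$ a functional $(A,\alpha)$-module. Let $(\bigoplus_{g\in G}\mathcal{E},U)$ be the twisted amplification of $\mathcal{E}$ described in the context. (i) There is a ($G$-equivariant) functional extension $\pi:(\mathcal{E},S)\to\big(\bigoplus_{g\in G}\mathcal{E},U\big)$. (ii) If $\Gamma:\mathcal{E}\to\mathcal{F}$ is a non-equivariant functional extension, and $(\bigoplus_{g\in G}\mathcal{F},V)$ is the analogous twisted amplification of $\mathcal{F}$, then $$\sigma:\Big(\bigoplus_{g\in G}\mathcal{E},U\Big)\to\Big(\bigoplus_{g\in G}\mathcal{F},V\Big),\qquad\sigma\Big(\bigoplus_{g\in G}\xi_g\Big)=\bigoplus_{g\in G}\Gamma(\xi_g),\qquad \sigma^*\Big(\bigoplus_{g\in G}\alpha_g\circ\phi_g\Big)=\bigoplus_{g\in G}\alpha_g\circ\Gamma^*(\phi_g)\quad(\phi_g\in\Theta_A(\mathcal{E}))$$ is an equivariant functional extension, and thus $\sigma\circ\pi$ is an equivariant functional extension of $(\mathcal{E},S)$.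
   Context: All algebras are (not necessarily unital, discrete) associative algebras over $\mathbb{C}$ which are quadratik, i.e. every element is a finite sum of products $ab$ of elements of the algebra. Every algebra $A$ carries a $G$-action $\alpha:G\to\mathrm{Aut}(A)$, written $(A,\alpha)$. Right $A$-modules are also $\mathbb{C}$-vector spaces. A $G$-action on a right $A$-module $M$ is a group homomorphism $S$ from $G$ to the invertible additive maps on $M$ with $S_g(\xi a)=S_g(\xi)\alpha_g(a)$. $\mathrm{Hom}_A(M,N)$ is the abelian group of all (not necessarily equivariant) right $A$-module homomorphisms $(M,S)\to(N,T)$, with $G$-action $g(\phi)=T_g\circ\phi\circ S_{g^{-1}}$. $\mathrm{Hom}_A(M,A)$ is a left $A$-module via $(a\phi)(\xi)=a\,\phi(\xi)$. A functional $A$-module is a right $A$-module $M$ with $G$-action together with a distinguished $G$-invariant left $A$-submodule $\Theta_A(M)\subseteq\mathrm{Hom}_A(M,A)$ (its functional space). A homomorphism of functional $A$-modules $\mathcal{E}\to\mathcal{F}$ is a pair $(U,U^* )$ with $U:\mathcal{E}\to\mathcal{F}$ a $G$-equivariant right $A$-module homomorphism and $U^*:\Theta_A(\mathcal{E})\to\Theta_A(\mathcal{F})$ a $G$-equivariant left $A$-module homomorphism such that $U^*(\phi)(U(\xi))=\phi(\xi)$ for all $\phi,\xi$. It is a functional extension if $U$ is injective and for all $\phi_1,\dots,\phi_k\in\Theta_A(\mathcal{E})$ and all $\eta\in\mathcal{F}$ there is $\xi\in\mathcal{E}$ with $U^*(\phi_i)(\eta)=\phi_i(\xi)$ for all $1\le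 i\le k$. ''Non-equivariant'' means that all $G$-actions and equivariance requirements are dropped (so $\mathcal{F}$ in (ii) is a functional module without $G$-action over the algebra $A$). Twisted amplification (for finite $G$): $\bigoplus_{g\in G}\mathcal{E}$ is the functional $(A,\alpha)$-module with right module multiplication $(\bigoplus_g\xi_g)\cdot a=\bigoplus_g\xi_g\alpha_{g^{-1}}(a)$, with the shift $G$-action $U_h(\bigoplus_g\xi_g)=\bigoplus_g\xi_{h^{-1}g}$, and with functional space consisting of the functionals $\bigoplus_g\alpha_g\circ\phi_g$ ($\phi_g\in\Theta_A(\mathcal{E})$), $(\bigoplus_g\alpha_g\circ\phi_g)(\bigoplus_g\xi_g)=\sum_g\alpha_g(\phi_g(\xi_g))$. The functional module $(\bigoplus_{g\in G}\mathcal{F},V)$ is defined by the same formulas from $\mathcal{F}$ (this needs no $G$-action on $\mathcal{F}$). *)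

(* Defs.v *)
From HB Require Import structures.
From mathcomp Require Import all_boot all_order all_algebra all_fingroup.
From mathcomp Require Import all_classical all_reals.
From mathcomp Require Export complex.

Set Implicit Arguments.
Unset Strict Implicit.
Unset Printing Implicit Defensive.

Import GRing.Theory.
Local Open Scope ring_scope.

(* The ground field K is instantiated by the complex numbers R[i] in the      *)
(* theorem.  MathComp rings are unital, hence the records below.              *)

Record quadAlg (K : fieldType) := QuadAlg {
  qa_sort :> lmodType K;
  qa_mul : qa_sort -> qa_sort -> qa_sort;
  qa_mulA : associative qa_mul;
  qa_mulDl : left_distributive qa_mul +%R;
  qa_mulDr : right_distributive qa_mul +%R;
  qa_scalel : forall (c : K) a b, qa_mul (c *: a) b = c *: qa_mul a b;
  qa_scaler : forall (c : K) a b, qa_mul a (c *: b) = c *: qa_mul a b;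
  qa_quadratik : forall a : qa_sort,
    exists s : seq (qa_sort * qa_sort), a = \sum_(p <- s) qa_mul p.1 p.2
}.

Record rmodule (K : fieldType) (A : quadAlg K) := RModule {
  rm_sort :> lmodType K;
  rm_act : rm_sort -> A -> rm_sort;
  rm_actA : forall x a b, rm_act x (qa_mul a b) = rm_act (rm_act x a) b;
  rm_actDl : forall x y a, rm_act (x + y) a = rm_act x a + rm_act y a;
  rm_actDr : forall x a b, rm_act x (a + b) = rm_act x a + rm_act x b;
  rm_scalel : forall (c : K) x a, rm_act (c *: x) a = c *: rm_act x a;
  rm_scaler : forall (c : K) x a, rm_act x (c *: a) = c *: rm_act x a
}.

Definition reg_rmodule (K : fieldType) (A : quadAlg K) : rmodule A :=
  @RModule K A A (@qa_mul K A) (@qa_mulA K A) (@qa_mulDl K A) (@qa_mulDr K A)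
    (@qa_scalel K A) (@qa_scaler K A).

Section Hom.
Variables (K : fieldType) (A : quadAlg K).

(* Module homomorphisms are additive but not required to be K-linear: module  *)
(* actions of a group are by additive maps only, and T_g \o phi \o S_(g^-1)   *)
(* must be a homomorphism again.                                              *)
Definition is_hom (M N : rmodule A) (f : M -> N) : Prop :=
  (forall x y, f (x + y) = f x + f y) /\
  (forall x a, f (rm_act x a) = rm_act (f x) a).

Definition hom_pred (M N : rmodule A) : {pred M -> N} := [pred f | `[< is_hom f >]].
Arguments hom_pred : clear implicits.

Lemma hom_zmod_closed (M N : rmodule A) : zmod_closed (hom_pred M N).
Proof.
have act0 a : rm_act (0 : N) a = 0.
  by have := rm_scalel 0 (0 : N) a; rewrite !scale0r.
have actN (x : N) a : rm_act (- x) a = - rm_act x a.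
  by rewrite -scaleN1r rm_scalel scaleN1r.
split=> [|f g].
  by apply/asboolP; split=> [x y|x a]; rewrite /= ?addr0 ?act0.
move=> /asboolP[fD fM] /asboolP[gD gM]; apply/asboolP; split=> [x y|x a].
  change (f (x + y) - g (x + y) = (f x - g x) + (f y - g y)).
  by rewrite fD gD opprD addrACA.
change (f (rm_act x a) - g (rm_act x a) = rm_act (f x - g x) a).
by rewrite fM gM rm_actDl actN.
Qed.

HB.instance Definition _ (M N : rmodule A) :=
  GRing.isZmodClosed.Build (M -> N) (hom_pred M N) (hom_zmod_closed M N).

Record Hom (M N : rmodule A) :=
  MkHom { hom_fun :> M -> N; _ : hom_fun \in hom_pred M N }.

HB.instance Definition _ M N := [isSub for @hom_fun M N].
HB.instance Definition _ M N := [Choice of Hom M N by <:].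
HB.instance Definition _ M N := [SubChoice_isSubZmodule of Hom M N by <:].

Definition mk_hom (M N : rmodule A) (f : M -> N) (fP : is_hom f) : Hom M N :=
  MkHom (introT (asboolP _) fP).

Lemma homP (M N : rmodule A) (f : Hom M N) : is_hom f.
Proof. by case: f => f fP; apply/asboolP. Qed.

Definition hom_comp (M N P : rmodule A) (g : Hom N P) (f : Hom M N) : Hom M P.
Proof.
apply: (@mk_hom _ _ (g \o f)).
by split=> [x y|x a] /=; rewrite ?((homP f).1, (homP f).2) ?((homP g).1, (homP g).2).
Defined.

Definition lmul_hom (M : rmodule A) (a : A) (phi : Hom M (reg_rmodule A)) :
  Hom M (reg_rmodule A).
Proof.
apply: (@mk_hom _ (reg_rmodule A) (fun x => qa_mul a (phi x))).
split=> [x y|x b]; first by rewrite (homP phi).1 qa_mulDr.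
by rewrite (homP phi).2 /= qa_mulA.
Defined.

End Hom.

Record fmodule (K : fieldType) (A : quadAlg K) := FModule {
  fm_mod :> rmodule A;
  fm_theta : zmodClosed (Hom fm_mod (reg_rmodule A));
  fm_theta_lmul : forall a phi, phi \in fm_theta -> lmul_hom a phi \in fm_theta
}.

Definition theta (K : fieldType) (A : quadAlg K) (E : fmodule A) : Type :=
  {phi : Hom E (reg_rmodule A) | phi \in fm_theta E}.

HB.instance Definition _ K A (E : @fmodule K A) := SubChoice.on (theta E).
HB.instance Definition _ K A (E : @fmodule K A) :=
  [SubChoice_isSubZmodule of theta E by <:].

Section FunctionalHom.
Variables (K : fieldType) (A : quadAlg K).

Definition theta_fun (E : fmodule A) (phi : theta E) : E -> A := hom_fun (val phi).

Definition theta_lmul (E : fmodule A) (a : A) (phi : theta E) : theta E :=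
  Sub (lmul_hom a (val phi)) (fm_theta_lmul a (valP phi)).

Record fhom (E F : fmodule A) := FHom {
  fh_map :> Hom E F;
  fh_star : {additive theta E -> theta F};
  fh_star_lmul : forall a phi,
    fh_star (theta_lmul a phi) = theta_lmul a (fh_star phi);
  fh_pairing : forall phi x,
    theta_fun (fh_star phi) (fh_map x) = theta_fun phi x
}.

Definition functional_extension (E F : fmodule A) (U : fhom E F) : Prop :=
  injective U /\
  forall (k : nat) (phi : 'I_k -> theta E) (eta : F),
    exists xi : E, forall i, theta_fun (fh_star U (phi i)) eta = theta_fun (phi i) xi.

Definition fhom_comp (E F H : fmodule A) (V : fhom F H) (U : fhom E F) : fhom E H.
Proof.
apply: (@FHom E H (hom_comp V U) (fh_star V \o fh_star U : {additive _ -> _})).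
- by move=> a phi /=; rewrite !fh_star_lmul.
- by move=> phi x; rewrite /= !fh_pairing.
Defined.

End FunctionalHom.

Section Equivariant.
Variables (K : fieldType) (G : finGroupType).

(* Invertibility of the maps follows from the two group laws. *)
Record algAction (A : quadAlg K) := AlgAction {
  aa_act :> G -> {linear A -> A};
  aa_mul : forall g a b, aa_act g (qa_mul a b) = qa_mul (aa_act g a) (aa_act g b);
  aa_act1 : forall a, aa_act 1%g a = a;
  aa_actM : forall g h a, aa_act (g * h)%g a = aa_act g (aa_act h a)
}.

Variables (A : quadAlg K) (alpha : algAction A).

Record modAction (M : rmodule A) := ModAction {
  ma_act :> G -> {additive M -> M};
  ma_mul : forall g x a, ma_act g (rm_act x a) = rm_act (ma_act g x) (alpha g a);
  ma_act1 : forall x, ma_act 1%g x = x;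
  ma_actM : forall g h x, ma_act (g * h)%g x = ma_act g (ma_act h x)
}.

Definition reg_action : modAction (reg_rmodule A) :=
  @ModAction (reg_rmodule A) (fun g => alpha g : {additive A -> A}) (aa_mul alpha) (aa_act1 alpha) (aa_actM alpha).

Definition hom_act (M N : rmodule A) (S : modAction M) (T : modAction N) (g : G)
  (phi : Hom M N) : Hom M N.
Proof.
apply: (@mk_hom _ _ _ _ (fun x => T g (phi (S g^-1%g x)))).
split=> [x y|x a]; first by rewrite !raddfD (homP phi).1 raddfD.
by rewrite ma_mul (homP phi).2 ma_mul -aa_actM mulgV aa_act1.
Defined.

Record gfmodule := GFModule {
  gf_fmod :> fmodule A;
  gf_act : modAction gf_fmod;
  gf_theta_inv : forall g phi, phi \in fm_theta gf_fmod ->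
    hom_act gf_act reg_action g phi \in fm_theta gf_fmod
}.

Definition theta_act (E : gfmodule) (g : G) (phi : theta E) : theta E :=
  Sub (hom_act (gf_act E) reg_action g (val phi)) (gf_theta_inv g (valP phi)).

Definition equivariant (E F : gfmodule) (U : fhom E F) : Prop :=
  (forall g x, U (gf_act E g x) = gf_act F g (U x)) /\
  (forall g phi, fh_star U (theta_act g phi) = theta_act g (fh_star U phi)).

Definition equivariant_functional_extension (E F : gfmodule) (U : fhom E F) : Prop :=
  equivariant U /\ functional_extension U.

Section Amplification.
Variable E : fmodule A.

Definition ampl_act (x : {ffun G -> E}) (a : A) : {ffun G -> E} :=
  [ffun g => rm_act (x g) (alpha g^-1%g a)].

Definition ampl_rmodule : rmodule A.
Proof.
apply: (@RModule K A {ffun G -> E} ampl_act) => [x a b|x y a|x a b|c x a|c x a];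
  apply/ffunP => g; rewrite !ffunE.
- by rewrite aa_mul rm_actA.
- by rewrite rm_actDl.
- by rewrite linearD rm_actDr.
- by rewrite rm_scalel.
- by rewrite linearZ rm_scaler.
Defined.

Definition shift (h : G) (x : ampl_rmodule) : ampl_rmodule :=
  [ffun g => x (h^-1 * g)%g].

Lemma shift_is_zmod_morphism h : zmod_morphism (shift h).
Proof. by move=> x y; apply/ffunP => g; rewrite !ffunE. Qed.

HB.instance Definition _ h :=
  GRing.isZmodMorphism.Build ampl_rmodule ampl_rmodule (shift h)
    (shift_is_zmod_morphism h).

Definition shift_action : modAction ampl_rmodule.
Proof.
apply: (@ModAction ampl_rmodule (fun h => shift h : {additive _ -> _}))
  => [h x a|x|h k x]; apply/ffunP => g; rewrite !ffunE.
- by congr rm_act; rewrite -aa_actM invMg invgK.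
- by rewrite invg1 mul1g.
- by rewrite invMg mulgA.
Defined.

Definition ampl_functional (phi : G -> theta E) : Hom ampl_rmodule (reg_rmodule A).
Proof.
apply: (@mk_hom _ _ ampl_rmodule (reg_rmodule A)
  (fun x => \sum_g alpha g (theta_fun (phi g) (x g)))).
split=> [x y|x a].
  rewrite -big_split /=; apply: eq_bigr => g _.
  by rewrite ffunE /theta_fun (homP (val (phi g))).1 linearD.
have mulr_sum (F : G -> A) : qa_mul (\sum_g F g) a = \sum_g qa_mul (F g) a.
  apply: (big_morph (fun b => qa_mul b a)) => [b c|]; first exact: qa_mulDl.
  by have := qa_scalel 0 (0 : A) a; rewrite !scale0r.
rewrite /= mulr_sum; apply: eq_bigr => g _.
by rewrite ffunE /theta_fun (homP (val (phi g))).2 aa_mul -aa_actM mulgV aa_act1.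
Defined.

Definition ampl_theta : {pred Hom ampl_rmodule (reg_rmodule A)} :=
  [pred psi | `[< exists phi : G -> theta E, psi = ampl_functional phi >]].

Lemma ampl_theta_zmod_closed : zmod_closed ampl_theta.
Proof.
split=> [|_ _ /asboolP[phi ->] /asboolP[psi ->]]; apply/asboolP.
  exists (fun=> 0); apply/val_inj/funext => x /=.
  by rewrite big1 // => g _; rewrite linear0.
exists (fun g => phi g - psi g); apply/val_inj/funext => x /=.
change (\sum_g alpha g (theta_fun (phi g) (x g)) -
        \sum_g alpha g (theta_fun (psi g) (x g)) =
        \sum_g alpha g (theta_fun (phi g - psi g) (x g))).
rewrite -sumrB; apply: eq_bigr => g _.
by rewrite -linearB.
Qed.

HB.instance Definition _ :=
  GRing.isZmodClosed.Build (Hom ampl_rmodule (reg_rmodule A)) ampl_theta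
    ampl_theta_zmod_closed.

Definition ampl_fmodule : fmodule A.
Proof.
apply: (@FModule K A ampl_rmodule ampl_theta) => a _ /asboolP[phi ->].
apply/asboolP; exists (fun g => theta_lmul (alpha g^-1%g a) (phi g)).
apply/val_inj/funext => x /=.
have mull_sum (F : G -> A) : qa_mul a (\sum_g F g) = \sum_g qa_mul a (F g).
  apply: (big_morph (qa_mul a)) => [b c|]; first exact: qa_mulDr.
  by have := qa_scaler 0 a (0 : A); rewrite !scale0r.
rewrite mull_sum; apply: eq_bigr => g _.
by rewrite /theta_fun /= aa_mul -aa_actM mulgV aa_act1.
Defined.

Definition ampl : gfmodule.
Proof.
apply: (@GFModule ampl_fmodule shift_action) => h _ /asboolP[phi ->].
apply/asboolP; exists (fun g => phi (h^-1 * g)%g).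
apply/val_inj/funext => x /=.
rewrite linear_sum [RHS](reindex_inj (mulgI h)) /=; apply: eq_bigr => g _.
by rewrite ffunE invgK mulKg -aa_actM.
Defined.

Definition ampl_sum (phi : G -> theta E) : theta ampl :=
  Sub (ampl_functional phi) (introT (asboolP _) (ex_intro _ phi erefl)).

End Amplification.
End Equivariant.

(* Main.v *)
From HB Require Import structures.
Require Import Defs.
From mathcomp Require Import all_boot all_order all_algebra all_fingroup.
From mathcomp Require Import all_classical all_reals.

(** The embedding [pi] spreads a vector over its translates, and its companion
    on functionals does the same for the translates of a functional:
      [pi xi = (n^-1 S_(g^-1) xi)_g]  and
      [pi^* phi = (+)_g alpha_g o (g^-1 phi)],  with [n] the order of [G].
    Each of the [n] summands of [pi^* phi (pi xi)] then equals [n^-1 phi xi],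
    so the pairing is preserved.  For an arbitrary [eta] in the amplification,
    [pi^* phi eta = phi (sum_g S_g (eta_g))], so [sum_g S_g (eta_g)] is one
    preimage that serves all functionals at once; this is the extension
    property.

    The factor [n^-1] is placed on the vectors and not on the functionals: the
    functional space is only an additive group stable under left
    multiplication by [A], and [A] may have no unit, so it need not contain
    [n^-1 phi].  Group elements act on the module by maps that are merely
    additive, but additive maps commute with division by an integer.

    For [sigma], the point is that a functional on the amplification determines
    its components (evaluate it on vectors supported at one group element), so
    that [sigma^*] may be defined componentwise.  All properties of [sigma]
    then reduce to those of [Gamma] in each component; for the extension
    property one picks a preimage for each component separately. *)

Set Implicit Arguments.
Unset Strict Implicit.
Unset Printing Implicit Defensive.

Import GRing.Theory.
Local Open Scope ring_scope.

(** * Additive maps and functionals *)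

Lemma raddf_scale_invn (K : fieldType) (V W : lmodType K)
    (f : {additive V -> W}) (n : nat) (x : V) :
  n%:R != 0 :> K -> f (n%:R^-1 *: x) = n%:R^-1 *: f x.
Proof.
move=> n0; apply: (scalerI n0).
by rewrite scaler_nat -raddfMn -scaler_nat !scalerA mulfV // !scale1r.
Qed.

Section Functionals.
Variables (K : fieldType) (A : quadAlg K).

Lemma eq_theta (E : fmodule A) (phi psi : theta E) :
  theta_fun phi =1 theta_fun psi -> phi = psi.
Proof. by move=> eq_phi; apply/val_inj/val_inj/funext. Qed.

Lemma theta_fun_is_additive (E : fmodule A) (phi : theta E) :
  zmod_morphism (theta_fun phi).
Proof.
have phiD := (homP (val phi)).1; move=> x y; rewrite /theta_fun.
by apply/eqP; rewrite eq_sym subr_eq -[X in _ == X]phiD subrK.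
Qed.

HB.instance Definition _ (E : fmodule A) (phi : theta E) :=
  GRing.isZmodMorphism.Build E A (theta_fun phi) (theta_fun_is_additive phi).

Lemma functional_extension_comp (E F H : fmodule A) (V : fhom F H)
    (U : fhom E F) :
  functional_extension V -> functional_extension U ->
  functional_extension (fhom_comp V U).
Proof.
move=> [Vinj Vext] [Uinj Uext]; split; first exact: inj_comp.
move=> k phi eta.
have [y Ey] := Vext k (fun i => fh_star U (phi i)) eta.
by have [xi Exi] := Uext k phi y; exists xi => i; rewrite -Exi -Ey.
Qed.

Lemma equivariant_comp (G : finGroupType) (alpha : algAction G A)
    (E F H : gfmodule alpha) (V : fhom F H) (U : fhom E F) :
  equivariant V -> equivariant U -> equivariant (fhom_comp V U).
Proof.
move=> [V1 V2] [U1 U2]; split=> [g x|g phi] /=; first by rewrite U1 V1.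
by rewrite U2 V2.
Qed.

End Functionals.

(** * Functionals on the twisted amplification *)

Section Amplification.
Variables (K : fieldType) (G : finGroupType) (A : quadAlg K).
Variable alpha : algAction G A.

Section Components.
Variable E : fmodule A.
Implicit Types (phi : G -> theta E) (psi : theta (ampl alpha E)).

Lemma ampl_sumE phi (x : {ffun G -> E}) :
  theta_fun (ampl_sum alpha phi) x = \sum_g alpha g (theta_fun (phi g) (x g)).
Proof. by []. Qed.

Lemma ampl_sumB phi phi' :
  ampl_sum alpha (fun g => phi g - phi' g) =
  ampl_sum alpha phi - ampl_sum alpha phi'.
Proof.
apply: eq_theta => x.
change (\sum_g alpha g (theta_fun (phi g) (x g) - theta_fun (phi' g) (x g)) =
        \sum_g alpha g (theta_fun (phi g) (x g)) -
        \sum_g alpha g (theta_fun (phi' g) (x g))).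
by rewrite -sumrB; apply: eq_bigr => g _; rewrite linearB.
Qed.

Lemma ampl_sum_lmul a phi :
  theta_lmul a (ampl_sum alpha phi) =
  ampl_sum alpha (fun g => theta_lmul (alpha g^-1%g a) (phi g)).
Proof.
apply: eq_theta => x.
change (qa_mul a (\sum_g alpha g (theta_fun (phi g) (x g))) =
  \sum_g alpha g (qa_mul (alpha g^-1%g a) (theta_fun (phi g) (x g)))).
rewrite (big_morph (qa_mul a) (qa_mulDr a) (id1 := 0)); last first.
  by have := qa_scaler 0 a (0 : A); rewrite !scale0r.
by apply: eq_bigr => g _; rewrite aa_mul -aa_actM mulgV aa_act1.
Qed.

Lemma ampl_sum_act h phi :
  theta_act (E := ampl alpha E) h (ampl_sum alpha phi) =
  ampl_sum alpha (fun g => phi (h^-1 * g)%g).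
Proof.
apply: eq_theta => x.
change (alpha h (\sum_g alpha g (theta_fun (phi g)
          (shift (alpha := alpha) h^-1%g x g))) =
  \sum_g alpha g (theta_fun (phi (h^-1 * g)%g) (x g))).
rewrite linear_sum [RHS](reindex_inj (mulgI h)) /=; apply: eq_bigr => g _.
by rewrite ffunE invgK mulKg -aa_actM.
Qed.

(** Evaluation on the vectors supported at a single group element recovers
    each component, since [alpha g] is invertible. *)
Lemma ampl_sum_inj phi phi' :
  ampl_sum alpha phi = ampl_sum alpha phi' -> phi =1 phi'.
Proof.
move=> eq_phi g; apply: eq_theta => x.
pose d : {ffun G -> E} := [ffun h => if h == g then x else 0].
have ev p : theta_fun (ampl_sum alpha p) d = alpha g (theta_fun (p g) x).
  rewrite ampl_sumE (bigD1 g) //= big1 ?addr0 => [|h /negPf hg].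
    by rewrite ffunE eqxx.
  by rewrite ffunE hg !raddf0.
have := ev phi; rewrite eq_phi ev => /(congr1 (alpha g^-1%g)).
by rewrite -!aa_actM mulVg !aa_act1.
Qed.

Definition ampl_coord psi : G -> theta E :=
  projT1 (cid (asboolW (valP psi))).

Lemma ampl_coordK psi : ampl_sum alpha (ampl_coord psi) = psi.
Proof.
by apply/val_inj; rewrite /ampl_coord; case: cid => phi Ephi /=; rewrite Ephi.
Qed.

Lemma ampl_sumK phi : ampl_coord (ampl_sum alpha phi) = phi.
Proof. by apply/funext/ampl_sum_inj; rewrite ampl_coordK. Qed.

Lemma ampl_coordB psi psi' :
  ampl_coord (psi - psi') = fun g => ampl_coord psi g - ampl_coord psi' g.
Proof.
rewrite -{1}(ampl_coordK psi) -{1}(ampl_coordK psi').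
by rewrite -ampl_sumB ampl_sumK.
Qed.

End Components.

(** * Embedding a module into its amplification *)

Section Embedding.
Variable E : gfmodule alpha.
Hypothesis cardG_neq0 : #|G|%:R != 0 :> K.
Local Notation S := (gf_act E).

Definition spread (x : E) : ampl alpha E :=
  [ffun g => #|G|%:R^-1 *: S g^-1%g x] : {ffun G -> E}.

Lemma spread_is_hom : is_hom (spread : E -> ampl alpha E).
Proof.
split=> [x y|x a]; apply/ffunP => g; rewrite !ffunE.
  by rewrite raddfD scalerDr.
by rewrite ma_mul rm_scalel.
Qed.

Definition spread_star (phi : theta E) : theta (ampl alpha E) :=
  ampl_sum alpha (fun g => theta_act g^-1%g phi).

Lemma spread_starE phi (y : {ffun G -> E}) :
  theta_fun (spread_star phi) y = theta_fun phi (\sum_g S g (y g)).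
Proof.
rewrite ampl_sumE raddf_sum; apply: eq_bigr => g _.
by rewrite /theta_fun /= -aa_actM mulgV aa_act1 invgK.
Qed.

Lemma spread_star_is_additive : zmod_morphism spread_star.
Proof.
move=> phi psi; apply: eq_theta => y.
change (theta_fun (spread_star (phi - psi)) y =
        theta_fun (spread_star phi) y - theta_fun (spread_star psi) y).
by rewrite !spread_starE.
Qed.

HB.instance Definition _ := GRing.isZmodMorphism.Build _ _ spread_star
  spread_star_is_additive.

Lemma spread_star_lmul a phi :
  spread_star (theta_lmul a phi) = theta_lmul a (spread_star phi).
Proof.
rewrite ampl_sum_lmul; congr ampl_sum; apply/funext => g.
by apply: eq_theta => x; rewrite /theta_fun /= aa_mul.
Qed.

(** The translates [S_g (n^-1 S_(g^-1) x)] are all equal to [n^-1 x], so the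
    [n] of them add up to [x]. *)
Lemma spread_pairing phi x :
  theta_fun (spread_star phi) (spread x) = theta_fun phi x.
Proof.
rewrite spread_starE; congr theta_fun.
under eq_bigr => g _.
  rewrite ffunE raddf_scale_invn // -ma_actM mulgV ma_act1; over.
by rewrite sumr_const -scaler_nat scalerA mulfV // scale1r.
Qed.

Definition spread_fhom : fhom E (ampl alpha E) :=
  @FHom K A E (ampl alpha E) (mk_hom spread_is_hom) spread_star
    spread_star_lmul spread_pairing.

Lemma spread_equivariant : equivariant spread_fhom.
Proof.
split=> [h x|h phi].
  by apply/ffunP => g; rewrite !ffunE -ma_actM invMg invgK.
rewrite /= /spread_star ampl_sum_act; congr ampl_sum; apply/funext => g.
apply: eq_theta => x.
by rewrite /theta_fun /= -aa_actM -ma_actM !invMg !invgK.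
Qed.

Lemma spread_functional_extension : functional_extension spread_fhom.
Proof.
split=> [x y /ffunP/(_ 1%g)|k phi eta].
  by rewrite !ffunE invg1 !ma_act1; apply: scalerI; rewrite invr_eq0.
by exists (\sum_g S g ((eta : {ffun G -> E}) g)) => i; rewrite spread_starE.
Qed.

End Embedding.

(** * Amplifying a homomorphism of functional modules *)

Section AmplifiedHom.
Variables (E F : fmodule A) (Gamma : fhom E F).

Definition ampl_map (x : ampl alpha E) : ampl alpha F :=
  [ffun g => Gamma ((x : {ffun G -> E}) g)] : {ffun G -> F}.

Lemma ampl_map_is_hom : is_hom (ampl_map : ampl alpha E -> ampl alpha F).
Proof.
have [GammaD GammaM] := homP Gamma.
by split=> [x y|x a]; apply/ffunP => g; rewrite !ffunE ?GammaD ?GammaM.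
Qed.

Definition ampl_star (psi : theta (ampl alpha E)) : theta (ampl alpha F) :=
  ampl_sum alpha (fun g => fh_star Gamma (ampl_coord psi g)).

Lemma ampl_star_sum phi :
  ampl_star (ampl_sum alpha phi) =
  ampl_sum alpha (fun g => fh_star Gamma (phi g)).
Proof. by rewrite /ampl_star ampl_sumK. Qed.

Lemma ampl_star_is_additive : zmod_morphism ampl_star.
Proof.
move=> psi psi'; rewrite /ampl_star ampl_coordB -ampl_sumB.
by congr ampl_sum; apply/funext => g; rewrite raddfB.
Qed.

HB.instance Definition _ := GRing.isZmodMorphism.Build _ _ ampl_star
  ampl_star_is_additive.

Lemma ampl_star_lmul a psi :
  ampl_star (theta_lmul a psi) = theta_lmul a (ampl_star psi).
Proof.
rewrite -(ampl_coordK psi) ampl_sum_lmul !ampl_star_sum ampl_sum_lmul.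
by congr ampl_sum; apply/funext => g; rewrite fh_star_lmul.
Qed.

Lemma ampl_pairing psi x :
  theta_fun (ampl_star psi) (ampl_map x) = theta_fun psi x.
Proof.
rewrite -(ampl_coordK psi) ampl_star_sum !ampl_sumE.
by apply: eq_bigr => g _; rewrite ffunE fh_pairing.
Qed.

Definition ampl_fhom : fhom (ampl alpha E) (ampl alpha F) :=
  @FHom K A (ampl alpha E) (ampl alpha F) (mk_hom ampl_map_is_hom) ampl_star
    ampl_star_lmul ampl_pairing.

Lemma ampl_fhom_equivariant : equivariant ampl_fhom.
Proof.
split=> [h x|h psi]; first by apply/ffunP => g; rewrite !ffunE.
by rewrite /= -(ampl_coordK psi) ampl_sum_act !ampl_star_sum ampl_sum_act.
Qed.

Lemma ampl_functional_extension :
  functional_extension Gamma -> functional_extension ampl_fhom.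
Proof.
move=> [Ginj Gext]; split=> [x y /ffunP eq_xy|k psi eta].
  by apply/ffunP => g; apply: Ginj; have := eq_xy g; rewrite !ffunE.
have /choice[xi Exi] g := Gext k (fun i => ampl_coord (psi i) g)
  ((eta : {ffun G -> F}) g).
exists (finfun xi : {ffun G -> E}) => i.
rewrite -[in RHS](ampl_coordK (psi i)) !ampl_sumE.
by apply: eq_bigr => g _; rewrite ffunE Exi.
Qed.

End AmplifiedHom.

End Amplification.

Theorem lemma5p1 (R : realType) (G : finGroupType) (A : quadAlg R[i])
    (alpha : algAction G A) (E : gfmodule alpha) :
  (exists pi : fhom E (ampl alpha E), equivariant_functional_extension pi) /\
  (forall (F : fmodule A) (Gamma : fhom E F),
    functional_extension Gamma ->
    exists sigma : fhom (ampl alpha E) (ampl alpha F),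
      [/\ forall xi : {ffun G -> E}, sigma xi = [ffun g => Gamma (xi g)],
          forall phi : G -> theta E,
            fh_star sigma (ampl_sum alpha phi) =
            ampl_sum alpha (fun g => fh_star Gamma (phi g)),
          equivariant_functional_extension sigma &
          forall pi : fhom E (ampl alpha E),
            equivariant_functional_extension pi ->
            equivariant_functional_extension (fhom_comp sigma pi)]).
Proof.
split.
  have cardG : #|G|%:R != 0 :> R[i].
    by rewrite Num.Theory.pnatr_eq0 -lt0n; apply/card_gt0P; exists 1%g.
  exists (spread_fhom E cardG).
  by split; [exact: spread_equivariant | exact: spread_functional_extension].
move=> F Gamma Gext; exists (ampl_fhom alpha Gamma).
have sigma_eq := ampl_fhom_equivariant alpha Gamma.
have sigma_ext := ampl_functional_extension alpha Gext.
split=> // [phi|pi [pi_eq pi_ext]]; first exact: ampl_star_sum.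
by split; [exact: equivariant_comp | exact: functional_extension_comp].
Qed.
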